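(* Let $S$ be a zero-divisor semigroup with zero-divisor graph $G=\Gamma(S)$. For a vertex $x$ of $G$, let $T_x$ be the set of all end vertices of $G$ adjacent to $x$, assume that $T_x$ is nonempty, and put $T=S\setminus T_x$. Then $T$ is a non-trivial sub-semigroup of $S$. If in addition $G$ has a cycle, then $\{x,0\}$ is a sub-semigroup of $S$.
   Context: All semigroups are commutative, written multiplicatively, and have a zero element $0$ with $0x=0$ for all $x$. A zero-divisor semigroup is such a semigroup $S$ in which every element is a zero-divisor (an element $x$ with $xy=0$ for some nonzero $y\in S$). The zero-divisor graph $\Gamma(S)$ is the undirected simple graph whose vertices are the nonzero zero-divisors of $S$ (here: all of $S\setminus\{0\}$), with distinct vertices $x,y$ adjacent if and only if $xy=0$. An end vertex is a vertex of degree one. ''Non-trivial'' means that $T\neq\{0\}$ and $T\neq S$.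
   Formalization: That T is a sub-semigroup is claimed only when S is not {0, x, x²}; for S = {0, x, x²} with x³ = 0 and x² ≠ 0, T_x = {x²} and T = {0, x} is not closed under multiplication, so the claim fails there. *)

(* Defs.v *)
From HB Require Import structures.
From mathcomp Require Export all_boot.
From mathcomp Require Export boolp classical_sets.
Set Implicit Arguments.
Unset Strict Implicit.
Unset Printing Implicit Defensive.

Open Scope classical_set_scope.
Open Scope group_scope.

Definition zero_divisor (S : semigroupType) (zero x : S) : Prop :=
  exists2 y : S, y != zero & x * y = zero.

Definition zero_divisor_semigroup (S : semigroupType) (zero : S) : Prop :=
  [/\ commutative (fun x y : S => x * y),
      (forall x : S, zero * x = zero)
    & forall x : S, zero_divisor zero x].

Definition zdg_vertex (S : semigroupType) (zero x : S) : Prop :=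
  x != zero /\ zero_divisor zero x.

(* In a commutative S the endpoints of an edge are automatically
   zero-divisors, hence vertices. *)
Definition zdg_adj (S : semigroupType) (zero : S) : rel S :=
  fun x y => [&& x != zero, y != zero, x != y & x * y == zero].

(* Degree one; S may be infinite, so this is stated without a vertex count. *)
Definition zdg_end (S : semigroupType) (zero y : S) : Prop :=
  zdg_vertex zero y /\ exists! z : S, zdg_adj zero y z.

Definition end_neighbours (S : semigroupType) (zero x : S) : set S :=
  [set y | zdg_end zero y /\ zdg_adj zero x y].

Definition zdg_has_cycle (S : semigroupType) (zero : S) : Prop :=
  exists c : seq S, (2 < size c)%N /\ ucycle (zdg_adj zero) c.

(* Semigroups here have a zero, so a sub-semigroup is required to contain the
   zero of S; in particular it is nonempty. *)
Definition subsemigroup (S : semigroupType) (zero : S) (A : set S) : Prop :=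
  A zero /\ forall a b : S, A a -> A b -> A (a * b).

Definition nontrivial_subset (S : semigroupType) (zero : S) (A : set S) : Prop :=
  A <> [set zero] /\ A <> [set: S].

(* S consists of 0, x and x^2 only. When x has an end neighbour y, this forces
   y = x^2 and x^3 = 0: the graph is the single edge x -- x^2, and
   S minus {x^2} = {0, x} is not closed under multiplication. This
   semigroup has to be excluded when claiming that S minus the end
   neighbours of x is a sub-semigroup. *)
Definition all_zero_or_power (S : semigroupType) (zero x : S) : Prop :=
  [set: S] = [set zero; x; x * x].

(* Main.v *)
Require Import Defs.

(** Everything comes from one observation: if [y] is an end vertex hanging on
    [x], then the annihilator of [y] is contained in [{0, x, y}]
    ([end_neighbour_ann]).

    Suppose a product [a * b] of two elements outside [T_x] is such a [y].
    Whatever kills [a] kills [y], so the annihilator of [a] also lies in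
    [{0, x, y}], and it is non-zero because every element is a zero-divisor.
    If [a <> x], this makes [a] an end vertex hanging on [x], a contradiction.
    Hence [a = x] ([factor_of_end_neighbour]), by symmetry [b = x], and
    [y = x * x].

    The case [y = x * x] is degenerate ([square_end_neighbour]): every [z]
    satisfies [(z * x) * y = 0], so that [z * x] is [0], [x] or [y], and each
    value puts [z] in the annihilator of [y]. Thus [S = {0, x, x * x}], the
    case excluded in the second claim.

    The third claim uses the same facts. As [(x * x) * y = 0], the square
    [x * x] is [0], [x] or [y]. If it were [y], the graph would have only the two
    vertices [x] and [x * x], too few for a cycle. *)

Section EndNeighbours.
#[local] Set Implicit Arguments.
#[local] Unset Strict Implicit.

Variables (S : semigroupType) (zero : S).
Hypothesis hS : zero_divisor_semigroup zero.

Let mulC (a b : S) : a * b = b * a. Proof. by case: hS => C _ _; apply: C. Qed.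
Let mul0 (a : S) : zero * a = zero. Proof. by case: hS. Qed.
Let mulz0 (a : S) : a * zero = zero. Proof. by rewrite mulC. Qed.
Let zdiv (a : S) : zero_divisor zero a. Proof. by case: hS. Qed.

(** A non-zero [z] distinct from [y] with [z * y = 0] is a neighbour of [y],
    and an end vertex adjacent to [x] has no neighbour besides [x]. *)
Lemma end_neighbour_ann (x y z : S) :
  end_neighbours zero x y -> z * y = zero -> [\/ z = zero, z = x | z = y].
Proof.
move=> [[_ [u [_ uniq_u]]] /and4P[x0 y0 xy /eqP xy0]] zy0.
have [->|z0] := eqVneq z zero; first exact: Or31.
have [->|zy] := eqVneq z y; first exact: Or33.
have ux : u = x by apply: uniq_u; rewrite /zdg_adj y0 x0 eq_sym xy mulC xy0 eqxx.
apply: Or32; rewrite -ux; apply/esym/uniq_u.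
by rewrite /zdg_adj y0 z0 eq_sym zy mulC zy0 eqxx.
Qed.

(** The annihilator of a factor [a] lies inside that of the product, so a
    neighbour of [a] is [x] or [a * b]. If [a <> x], then [a * b] is ruled out,
    since its only neighbour is [x], and [a] is itself an end vertex at [x]. *)
Lemma factor_of_end_neighbour (x a b : S) :
  end_neighbours zero x (a * b) -> ~ end_neighbours zero x a -> a = x.
Proof.
move=> Ty nTa; set y := a * b in Ty.
have [_ /and4P[x0 y0 _ _]] := Ty.
have [//|ax] := eqVneq a x.
have a0 : a != zero by apply: contraNneq y0; rewrite /y => ->; rewrite mul0.
have ann_a c : a * c = zero -> [\/ c = zero, c = x | c = y].
  by move=> ac0; apply: end_neighbour_ann Ty _; rewrite /y mulgA (mulC c) ac0 mul0.
(* [a * y = 0] would put [a] among [0], [x], [y], all of which are excluded. *)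
have ay0 : a * y <> zero.
  case/(end_neighbour_ann Ty) => e.
  - by rewrite e eqxx in a0.
  - by rewrite e eqxx in ax.
  - by apply: nTa; rewrite e.
have ax0 : a * x = zero.
  have [c c0 ac0] := zdiv a; have cE := ann_a c ac0.
  by case: cE c0 ac0 => -> //; rewrite eqxx.
have adj_ax : zdg_adj zero a x by rewrite /zdg_adj a0 x0 ax ax0 eqxx.
case: nTa; split; last by rewrite /zdg_adj x0 a0 eq_sym ax mulC ax0 eqxx.
split; first by split=> //; exact: zdiv.
exists x; split=> // z /and4P[_ z0 _ /eqP az0].
have zE := ann_a z az0.
by case: zE z0 az0 => -> //; rewrite eqxx.
Qed.

(** Multiplication by [x] sends all of [S] into the annihilator of [x * x],
    which lies in [{0, x, x * x}]. Whichever of these [z * x] is, [z] itself is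
    killed by [x * x], hence is one of the three. *)
Lemma square_end_neighbour (x : S) :
  end_neighbours zero x (x * x) -> all_zero_or_power zero x.
Proof.
set y := x * x => Ty; have [_ /and4P[x0 y0 _ /eqP xy0]] := Ty.
apply/seteqP; split=> // z _.
suff zy0 : z * y = zero.
  by case: (end_neighbour_ann Ty zy0) => ->; [left; left|left; right|right].
have zxy0 : (z * x) * y = zero by rewrite -mulgA xy0 mulz0.
case: (end_neighbour_ann Ty zxy0) => zx.
- by rewrite /y mulgA zx mul0.
- (* A non-zero [w] with [z * w = 0] satisfies [x * w = z * x * w = 0],
     hence [y * w = 0]; it is not [x], so it is [y]. *)
  have [w w0 zw0] := zdiv z.
  have wy0 : w * y = zero.
    by rewrite mulC /y -mulgA -{2}zx -(mulgA z) (mulC x w) (mulgA z) zw0 mul0 mulz0.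
  case: (end_neighbour_ann Ty wy0) => e; last by rewrite -e.
  + by rewrite e eqxx in w0.
  + by rewrite e zx in zw0; rewrite zw0 eqxx in x0.
- by rewrite /y mulgA zx mulC.
Qed.

End EndNeighbours.

Lemma all_zero_or_power_acyclic (S : semigroupType) (zero x : S) :
  all_zero_or_power zero x -> ~ zdg_has_cycle zero.
Proof.
move=> allS [[|a [|b [|d c]]] [] //= _ /andP[/=]].
case/and3P=> /and4P[a0 b0 ab _] /and4P[_ d0 bd _] _.
rewrite !inE !negb_or => /andP[/and3P[_ ad _] _].
have vertexE v : v != zero -> v = x \/ v = x * x.
  have : [set: S] v by [].
  by rewrite allS => -[[->|->]|->]; [rewrite eqxx|left|right].
move: ab bd ad.
by case: (vertexE a a0) => ->; case: (vertexE b b0) => ->;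
  case: (vertexE d d0) => ->; rewrite ?eqxx.
Qed.

Theorem corollary2p2 (S : semigroupType) (zero : S)
    (hS : zero_divisor_semigroup zero)
    (x : S) (hx : zdg_vertex zero x)
    (hTx : end_neighbours zero x !=set0) :
  [/\ nontrivial_subset zero (~` end_neighbours zero x),
      (~ all_zero_or_power zero x ->
         subsemigroup zero (~` end_neighbours zero x))
    & (zdg_has_cycle zero -> subsemigroup zero [set zero; x])].
Proof.
have [x0 _] := hx; have [y Ty] := hTx.
have [mulC mul0 _] := hS.
split.
- split=> eqT.
  + have : (~` end_neighbours zero x) x by move=> [_]; rewrite /zdg_adj eqxx !andbF.
    by rewrite eqT /= => e; rewrite e eqxx in x0.
  + have : [set: S] y by [].
    by rewrite -eqT.
- move=> nS; split; first by move=> [_]; rewrite /zdg_adj eqxx andbF.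
  move=> a b Ta Tb Tab; apply: nS.
  have ax := factor_of_end_neighbour hS Tab Ta.
  have Tba : end_neighbours zero x (b * a) by rewrite [b * a]mulC.
  have bx := factor_of_end_neighbour hS Tba Tb.
  by apply: square_end_neighbour => //; rewrite -{2}ax -{2}bx.
- move=> cyc; split; first by left.
  have xx : [set zero; x] (x * x).
    have [_ /and4P[_ _ _ /eqP xy0]] := Ty.
    have xxy0 : (x * x) * y = zero by rewrite -mulgA xy0 [x * zero]mulC mul0.
    case: (end_neighbour_ann hS Ty xxy0) => e; [by left|by right|].
    suff allS : all_zero_or_power zero x.
      by case: (all_zero_or_power_acyclic _ _ _ allS cyc).
    by apply: square_end_neighbour => //; rewrite e.
  move=> a b [->|->] [->|->] //; left; rewrite ?mul0 //.
  by rewrite [x * zero]mulC mul0.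
Qed.
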